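(* Let $n$ be a positive integer that is a multiple of $2$, let $G=\mathbb{Z}/n\mathbb{Z}$ with Lee distance $\delta$, and let $u(g,h)=\delta(g,h)^{-1}$ for $g\neq h$ in $G$, with corresponding energy kernel $A$, total energy $E_{\text{tot}}$ and maximal energy $E_{\text{max}}$. Then the fractional energy $(x|Ax)$ over all $x\in V=\mathbb{R}^G$ with $(x|x)=(x|\mathbf{1})=n/2$ is minimised by the characteristic vectors $x_{S_{\text{even}}}$ and $x_{S_{\text{odd}}}$ of the checkerboard configurations \[ S_{\text{even}}=\{g\in G\mid g\text{ even}\},\qquad S_{\text{odd}}=\{g\in G\mid g\text{ odd}\}, \] and only by these. As a consequence, both the total energy $E_{\text{tot}}(S)$ and the maximal energy $E_{\text{max}}(S)$ among all subsets $S\subseteq G$ with $|S|=n/2$ are minimised by $S_{\text{even}}$ and $S_{\text{odd}}$, and only by these.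
   Context: Lee distance: form the graph on $G=\mathbb{Z}/n\mathbb{Z}$ in which two elements are joined by an edge if they differ by $\pm1$; $\delta(g,h)$ is the length of a shortest path from $g$ to $h$ in this graph. Since $n$ is even, parity of elements of $G$ is well defined. For $S\subseteq G$ and $h\in S$, put $E_h(S)=\sum_{g\in S\setminus\{h\}}u(h,g)$, $E_{\text{max}}(S)=\max_{h\in S}E_h(S)$ and $E_{\text{tot}}(S)=\sum_{h\in S}E_h(S)$. $V=\mathbb{R}^G$ is the space of real-valued functions on $G$, with inner product $(x|y)=\sum_{g\in G}x(g)y(g)$; $\mathbf{1}\in V$ is the all-one vector; $x_S\in V$ is the characteristic (0/1) vector of $S\subseteq G$. The energy kernel $A$ is the linear map $V\to V$ given by $(Ax)(h)=\sum_{g\in G,\,g\neq 0}u(g,0)\,x(h-g)$. *)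

(* Defs.v *)
From mathcomp Require Import all_boot all_order all_algebra.
From mathcomp Require Import reals.
Set Implicit Arguments.
Unset Strict Implicit.
Unset Printing Implicit Defensive.
Import Order.TTheory GRing.Theory Num.Theory.
Local Open Scope ring_scope.

Definition lee_adj n : rel 'Z_n :=
  fun g h => (g - h == 1) || (g - h == - 1).

Definition lee_walk n (g h : 'Z_n) (k : nat) : bool :=
  [exists p : k.-tuple 'Z_n, path (@lee_adj n) g p && (last g p == h)].

Fact lee_connected n (g h : 'Z_n) : exists k, lee_walk g h k.
Proof.
have walk k (x : 'Z_n) : lee_walk x (x + k%:R) k.
  elim: k x => [|k IHk] x.
    by apply/existsP; exists [tuple]; rewrite /= addr0.
  have /existsP[p /andP[xp /eqP lp]] := IHk (x + 1).
  apply/existsP; exists [tuple of x + 1 :: p].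
  rewrite /= xp lp -addrA -mulrS eqxx !andbT /lee_adj.
  by rewrite opprD addrA subrr add0r eqxx orbT.
exists (h - g : 'Z_n); have := walk (h - g : 'Z_n) g.
by rewrite natr_Zp addrC subrK.
Qed.

Definition lee_dist n (g h : 'Z_n) : nat := ex_minn (lee_connected g h).

(* At g = h this is 0^-1 = 0; the diagonal values are never used below. *)
Definition lee_potential (R : realType) n (g h : 'Z_n) : R :=
  (lee_dist g h)%:R^-1.

Section Energy.
Variables (R : realType) (n : nat).
Implicit Types (u : 'Z_n -> 'Z_n -> R) (S : {set 'Z_n}) (h : 'Z_n).
Implicit Types x y : {ffun 'Z_n -> R}.

Definition energy u S h : R := \sum_(g in S :\ h) u h g.

Definition total_energy u S : R := \sum_(h in S) energy u S h.

(* Seeding the iterated maximum with a value taken on S makes it the genuine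
   maximum whatever the signs of u; only S = set0 gets a default value. *)
Definition max_energy u S : R :=
  if [pick h in S] is Some h0
  then \big[Num.max/energy u S h0]_(h in S) energy u S h else 0.

Lemma max_energy_ge u S h : h \in S -> energy u S h <= max_energy u S.
Proof.
rewrite /max_energy; case: pickP => [h0 _ hS | S0]; last by rewrite S0.
exact: le_bigmax_cond.
Qed.

Lemma max_energy_attained u S :
  S != set0 -> exists2 h, h \in S & max_energy u S = energy u S h.
Proof.
move=> /set0Pn[h1 h1S]; rewrite /max_energy.
case: pickP => [h0 h0S | /(_ h1)]; last by rewrite h1S.
apply: (big_ind (fun m => exists2 h, h \in S & m = energy u S h)).
- by exists h0.
- by move=> a b ha hb; rewrite /Num.max; case: ifP.
- by move=> h hS; exists h.
Qed.

Definition inner x y : R := \sum_g x g * y g.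

Definition all_one : {ffun 'Z_n -> R} := [ffun=> 1].

Definition char_vec S : {ffun 'Z_n -> R} := [ffun g => (g \in S)%:R].

Definition energy_kernel u x : {ffun 'Z_n -> R} :=
  [ffun h => \sum_(g | g != 0) u g 0 * x (h - g)].

Fact energy_kernel_is_linear u :
  linear (energy_kernel u : {ffun 'Z_n -> R^o} -> {ffun 'Z_n -> R^o}).
Proof.
move=> a x y; apply/ffunP => h; rewrite !ffunE scaler_sumr -big_split /=.
apply: eq_bigr => g _; rewrite !ffunE mulrDr; congr (_ + _).
exact: mulrCA.
Qed.

End Energy.

Arguments all_one {R n}.

(* The parity of a class is that of its representative in [0, n[; it is
   intrinsic when n is even and positive. *)
Definition S_even n : {set 'Z_n} := [set g : 'Z_n | ~~ odd g].
Definition S_odd n : {set 'Z_n} := [set g : 'Z_n | odd g].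

Definition minimizer (R : realType) (T : Type) (P : T -> Prop) (f : T -> R)
  (x : T) : Prop := P x /\ forall y, P y -> f x <= f y.

(* Main.v *)
(** For [x] with [(x|x) = (x|1) = n/2] put [z h = (-1)^h (x h - 1/2)]; then
[(x|Ax)] is a constant plus a quadratic form in [z], diagonalised by the
characters of Z/n, in which the [k]-th Fourier mode of [z] is weighted by
[lambda_(k + n/2) - lambda_(n/2)], with [lambda] the eigenvalues of [A]. With
[m = n/2] this weight is twice the value at [theta = k pi / m] of
[P(theta) = sum_(0<g<=m) (-1)^g/g (cos (g theta) - 1)] (last term halved), and
[P'(theta) = tan(theta/2) (1 - (-1)^m cos(m theta)) / 2 >= 0] on [(0, pi)], so
the weight is positive for [k <> 0]. Hence the minimum is reached exactly when
[z] is constant, i.e. [z = 1/2] or [z = -1/2], which are the two checkerboards.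
For sets, [E_tot S <= |S| E_max S], with equality for the checkerboards. *)
Require Import Defs.
From mathcomp Require Import all_boot all_order all_algebra.
From mathcomp Require Import reals.
From mathcomp Require Import ring lra zify.
From mathcomp Require Import boolp functions topology normedtype derive realfun trigo.
Set Implicit Arguments.
Unset Strict Implicit.
Unset Printing Implicit Defensive.
Import Order.TTheory GRing.Theory Num.Theory.
Import numFieldNormedType.Exports.
Local Open Scope ring_scope.

(** * Monotonicity and positivity of the alternating cosine sum *)

Definition alt_term {R : realType} (g : nat) (x : R) : R :=
  (-1) ^+ g * g%:R^-1 * (cos (g%:R * x) - 1).

(* The last term is halved because -m = m in Z/2m. *)
Definition alt_sum {R : realType} (m : nat) (x : R) : R :=
  \sum_(g < m) alt_term g x + alt_term m x / 2.

Definition alt_sum_deriv {R : realType} (m : nat) (x : R) : R :=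
  - (\sum_(g < m) (-1) ^+ g * sin (g%:R * x)) - (-1) ^+ m * sin (m%:R * x) / 2.

Lemma alt_term0 (R : realType) (g : nat) : alt_term g (0 : R) = 0.
Proof. by rewrite /alt_term mulr0 cos0 subrr mulr0. Qed.

Lemma alt_sum0 (R : realType) (m : nat) : alt_sum m (0 : R) = 0.
Proof. by rewrite /alt_sum alt_term0 mul0r addr0 big1 // => g _; rewrite alt_term0. Qed.

Lemma is_derive_alt_term (R : realType) (g : nat) (x : R) :
  is_derive x 1 (@alt_term R g) (- ((-1) ^+ g * sin (g%:R * x))).
Proof.
have dlin : is_derive x 1 (fun t : R => g%:R * t) g%:R.
  by apply: is_derive_eq; rewrite /GRing.scale /= mulr1.
have dcos := is_derive1_comp (is_derive_cos (g%:R * x)) dlin.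
have -> : @alt_term R g =
    ((-1) ^+ g * g%:R^-1) \*: ((@cos R \o (fun t : R => g%:R * t)) - cst 1).
  by [].
apply: is_derive_eq; rewrite subr0 /GRing.scale /=.
(* At [g = 0] the product [g * g^-1] is 0 instead of 1, but [sin 0 = 0] makes both sides vanish. *)
case: g {dlin dcos} => [|g]; first by rewrite !mul0r sin0; ring.
have := pnatr_eq0 R g.+1; move: (g.+1%:R) => w w0; by field; rewrite w0.
Qed.

Lemma is_derive_alt_sum (R : realType) (m : nat) (x : R) :
  is_derive x 1 (@alt_sum R m) (alt_sum_deriv m x).
Proof.
have d (g : nat) := is_derive_alt_term g x.
have -> : @alt_sum R m =
    (\sum_(g < m) @alt_term R g) + 2^-1 \*: @alt_term R m.
  by apply/funext => t; rewrite /alt_sum fctE fct_sumE mulrC.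
apply: is_derive_eq; rewrite /alt_sum_deriv -sumrN /GRing.scale /=; ring.
Qed.

(** Telescoping: from [m] to [m + 1] both sides grow by [(-1)^m sin(x/2) (cos((m+1)x) + cos(mx))].
    The factor [2 cos(x/2)] clears the denominator of [tan(x/2)]. *)
Lemma alt_sum_derivE (R : realType) (m : nat) (x : R) :
  2 * cos (x / 2) * alt_sum_deriv m x =
  sin (x / 2) * (1 - (-1) ^+ m * cos (m%:R * x)).
Proof.
set h := x / 2.
have xh : x = h *+ 2 by rewrite /h; field.
clearbody h.
rewrite /alt_sum_deriv.
elim: m => [|m IH]; first by rewrite big_ord0 mul0r sin0 cos0 expr0; ring.
have Sx : m.+1%:R * x = m%:R * x + h *+ 2 by rewrite -xh mulrSr mulrDl mul1r.
rewrite big_ord_recr /= Sx (sinD (m%:R * x)) (cosD (m%:R * x)) exprSr.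
move: IH; rewrite sin_mulr2n cos_mulr2n.
have := cos2Dsin2 h.
set S := \sum_(i < m) _.
set a := sin (_ * x); set b := cos (_ * x); set c := cos h; set s := sin h; set e := _ ^+ m.
move=> cs IH.
have -> : 2 * c * (- (S + e * a) - e * -1 * (a * (c ^+ 2 *+ 2 - 1) + b * (c * s *+ 2)) / 2)
  = 2 * c * (- S - e * a / 2) - c * e * a * 2 + c * e * a +
    c * e * (a * (c ^+ 2 *+ 2 - 1) + b * (c * s *+ 2)) by field.
rewrite IH.
(* The remaining polynomial identity holds only modulo [c^2 + s^2 = 1]; [e2] covers the [c^2 s] that
   appears as [c * (c * s)]. *)
have -> : c ^+ 2 = 1 - s ^+ 2 by rewrite -cs addrK.
have e2 : c * (c * s) = (1 - s ^+ 2) * s by rewrite -cs; ring.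
have -> : c * e * (a * ((1 - s ^+ 2) *+ 2 - 1) + b * (c * s *+ 2)) =
  c * e * a * ((1 - s ^+ 2) *+ 2 - 1) + e * b * (c * (c * s)) *+ 2 by ring.
rewrite e2; ring.
Qed.

Lemma alt_sum_mvt (R : realType) (m : nat) (x y : R) : x < y ->
  exists2 c : R, x < c < y & alt_sum m y - alt_sum m x = alt_sum_deriv m c * (y - x).
Proof.
move=> xy.
have [||c] := @MVT R (@alt_sum R m) (@alt_sum_deriv R m) x y xy.
- by move=> t _; exact: is_derive_alt_sum.
- apply: derivable_within_continuous => t _.
  exact: (@ex_derive _ _ _ _ _ _ _ (is_derive_alt_sum m t)).
- by rewrite in_itv /=; exists c.
Qed.

Lemma alt_sum_deriv_ge0 (R : realType) (m : nat) (x : R) :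
  0 < x < pi -> 0 <= alt_sum_deriv m x.
Proof.
move=> /andP[x0 xpi].
have c0 : 0 < 2 * cos (x / 2) by rewrite mulr_gt0 // cos_gt0_pihalf; lra.
rewrite -(pmulr_rge0 _ c0) alt_sum_derivE mulr_ge0 //.
  by apply: sin_ge0_pi; apply/andP; split; lra.
have := cos_max (m%:R * x); rewrite ler_norml => /andP[cN1 c1].
by rewrite -signr_odd; case: odd; rewrite ?expr0 ?expr1; lra.
Qed.

Lemma alt_sum_deriv_gt0 (R : realType) (m : nat) (x : R) :
  0 < x < pi -> 0 < m%:R * x < pi -> 0 < alt_sum_deriv m x.
Proof.
move=> /andP[x0 xpi] mx.
have c0 : 0 < 2 * cos (x / 2) by rewrite mulr_gt0 // cos_gt0_pihalf; lra.
rewrite -(pmulr_rgt0 _ c0) alt_sum_derivE mulr_gt0 //.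
  by apply: sin_gt0_pi; apply/andP; split; lra.
have := cos2Dsin2 (m%:R * x); have := sin_gt0_pi mx => s0 cs.
(* A point of the unit circle with positive sine has cosine strictly between -1 and 1, whichever
   sign [(-1)^m] has. *)
have c1 : cos (m%:R * x) < 1 by nra.
have cN1 : -1 < cos (m%:R * x) by nra.
by rewrite -signr_odd; case: odd; rewrite ?expr0 ?expr1; lra.
Qed.

(** The sum is 0 at 0, increases strictly up to [pi / m], and does not decrease from there to [pi].
    The range contains every [k pi / m] with [1 <= k <= m]. *)
Lemma alt_sum_gt0 (R : realType) (m : nat) (x : R) : (0 < m)%N ->
  pi / m%:R <= x <= pi -> 0 < alt_sum m x.
Proof.
move=> m0 /andP[mx xpi].
have mR : (0 : R) < m%:R by rewrite ltr0n.
have m1 : (1 : R) <= m%:R by rewrite ler1n.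
have p0 := pi_gt0 R.
have pm0 : (0 : R) < pi / m%:R by rewrite divr_gt0.
have pmpi : (pi : R) / m%:R <= pi by rewrite ler_pdivrMr // ler_peMr // ltW.
have first_step : (0 : R) < alt_sum m (pi / m%:R).
  have [c /andP[c0 cpm]] := alt_sum_mvt m pm0.
  rewrite alt_sum0 !subr0 => ->; rewrite mulr_gt0 // alt_sum_deriv_gt0 //.
    by rewrite c0 (lt_le_trans cpm).
  by rewrite mulr_gt0 //= mulrC -ltr_pdivlMr.
have [->//|xm] := eqVneq x (pi / m%:R).
have mx' : pi / m%:R < x by rewrite lt_neqAle eq_sym xm.
have [c /andP[c0 cx] /eqP] := alt_sum_mvt m mx'.
rewrite subr_eq => /eqP ->.
rewrite ltr_wpDl // mulr_ge0 //; last by rewrite subr_ge0.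
by rewrite alt_sum_deriv_ge0 // (lt_trans pm0) // (lt_le_trans cx).
Qed.

(** * Representatives in ['Z_n] and a closed form of the Lee distance *)

Lemma val_ZpD (n : nat) (x y : 'Z_n) : (1 < n)%N -> (x + y : 'Z_n) = ((x + y) %% n)%N :> nat.
Proof. by move=> n1 /=; congr (_ %% _)%N; exact: Zp_cast. Qed.

Lemma val_ZpM (n : nat) (x y : 'Z_n) : (1 < n)%N -> (x * y : 'Z_n) = ((x * y) %% n)%N :> nat.
Proof. by move=> n1 /=; congr (_ %% _)%N; exact: Zp_cast. Qed.

Lemma val_ZpN (n : nat) (x : 'Z_n) : (1 < n)%N -> (- x : 'Z_n) = ((n - x) %% n)%N :> nat.
Proof. by move=> n1 /=; congr ((_ - _) %% _)%N; exact: Zp_cast. Qed.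

Lemma ltn_Zp (n : nat) (x : 'Z_n) : (1 < n)%N -> (x < n)%N.
Proof. by move=> n1; apply: leq_trans (ltn_ord x) _; rewrite Zp_cast. Qed.

Lemma sum_Zp (R : realType) (n : nat) (F : nat -> R) : (1 < n)%N ->
  \sum_(g : 'Z_n) F g = \sum_(i < n) F i.
Proof. by move=> n1; rewrite -!(big_mkord xpredT F) Zp_cast. Qed.

Lemma card_ord_Zp (n : nat) : (1 < n)%N -> #|'Z_n| = n.
Proof. by move=> n1; rewrite card_ord Zp_cast. Qed.

Lemma odd_ZpB (n : nat) (x y : 'Z_n) : (1 < n)%N -> ~~ odd n ->
  odd (x - y : 'Z_n)%R = odd x (+) odd y.
Proof.
move=> n1 /negbTE en; rewrite val_ZpD // val_ZpN //.
by rewrite odd_mod // oddD odd_mod // oddB ?en // ltnW // ltn_Zp.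
Qed.

Definition lee_weight (n d : nat) : nat := minn d (n - d).

(** One edge changes the weight by at most 1, so a walk is at least as long as the weight of the
    difference of its ends. *)
Lemma lee_weight_step (n : nat) (d : 'Z_n) : (1 < n)%N ->
  (lee_weight n (d + 1)%R <= (lee_weight n d).+1)%N /\
  (lee_weight n d <= (lee_weight n (d + 1)%R).+1)%N.
Proof.
move=> n1; have dn := ltn_Zp d n1; rewrite val_ZpD //.
have -> : (1 : 'Z_n) = 1%N :> nat by [].
move: (nat_of_ord d) dn => {}d dn.
rewrite /lee_weight; have [dn1|dn1] := ltnP (d + 1) n.
  by rewrite modn_small //; split; lia.
(* Wrap-around: the weight drops from 1 at [n - 1] to 0. *)
have -> : (d + 1 = n)%N by lia.
by rewrite modnn; split; lia.
Qed.

Lemma lee_weightN (n : nat) (d : 'Z_n) : (1 < n)%N ->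
  lee_weight n (- d)%R = lee_weight n d.
Proof.
move=> n1; have dn := ltn_Zp d n1; rewrite val_ZpN // /lee_weight.
move: (nat_of_ord d) dn => {}d dn.
have [->|d0] := posnP d; first by rewrite subn0 modnn !min0n.
by rewrite modn_small; lia.
Qed.

(** Walks in a constant direction [s] realise both arcs between two points, and so bound the
    distance from above. *)
Lemma lee_walk_nat (n k : nat) (x s : 'Z_n) : (s == 1) || (s == -1) ->
  lee_walk x (x + s * k%:R) k.
Proof.
move=> s1; elim: k x => [|k IHk] x.
  by apply/existsP; exists [tuple]; rewrite /= mulr0 addr0.
have /existsP[p /andP[xp /eqP lp]] := IHk (x + s).
apply/existsP; exists [tuple of x + s :: p].
rewrite /= xp lp -addrA [k.+1%:R]mulrS mulrDr mulr1 eqxx !andbT /lee_adj.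
rewrite opprD addrA subrr add0r.
by case/orP: s1 => /eqP ->; rewrite ?opprK eqxx ?orbT.
Qed.

Lemma lee_walk_ge (n k : nat) (g h : 'Z_n) : (1 < n)%N ->
  lee_walk g h k -> (lee_weight n (h - g)%R <= k)%N.
Proof.
move=> n1 /existsP[p]; elim: k g p => [|k IHk] g p.
  by rewrite (tuple0 p) => /andP[_ /eqP <-]; rewrite [last _ _]/= subrr /lee_weight min0n.
case/tupleP: p => y p; rewrite [path _ _ _]/= [last _ _]/= -andbA => /and3P[gy yp lp].
have := IHk y p; rewrite yp lp => /(_ isT) le_k.
have [s1 _] := lee_weight_step (h - y) n1.
have [_ s2] := lee_weight_step (h - g) n1.
case/orP: gy => /eqP gy.
  have e : h - g + 1 = h - y by rewrite -gy addrA subrK.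
  by rewrite e in s2; rewrite (leq_trans s2).
have e : h - y + 1 = h - g by rewrite -[1]opprK -gy opprB addrA subrK.
by rewrite e in s1; rewrite (leq_trans s1).
Qed.

Lemma lee_distE (n : nat) (g h : 'Z_n) : (1 < n)%N ->
  lee_dist g h = lee_weight n (h - g)%R.
Proof.
move=> n1; rewrite /lee_dist; case: ex_minnP => k /(lee_walk_ge n1) ge_k min_k.
apply/eqP; rewrite eqn_leq ge_k andbT leq_min; apply/andP; split; apply: min_k.
  have := @lee_walk_nat n (h - g : 'Z_n)%R g 1.
  by rewrite eqxx => /(_ isT); rewrite mul1r natr_Zp addrC subrK.
(* The complementary arc is walked downwards; it ends at [h] because [n] is 0 in ['Z_n]. *)
have := @lee_walk_nat n (n - (h - g : 'Z_n)%R) g (-1).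
rewrite eqxx orbT => /(_ isT).
rewrite natrB ?natr_Zp; last exact/ltnW/ltn_Zp.
by rewrite (pchar_Zp n1) sub0r mulN1r opprK addrC subrK.
Qed.

Lemma lee_potentialE (R : realType) (n : nat) (g h : 'Z_n) : (1 < n)%N ->
  lee_potential R g h = (lee_weight n (g - h)%R)%:R^-1.
Proof. by move=> n1; rewrite /lee_potential lee_distE // -opprB lee_weightN. Qed.

(** * Real characters of Z/n, autocorrelation and power spectrum *)

Definition zcos {R : realType} {n : nat} (d : 'Z_n) : R := cos (d%:R * (pi *+ 2 / n%:R)).
Definition zsin {R : realType} {n : nat} (d : 'Z_n) : R := sin (d%:R * (pi *+ 2 / n%:R)).

Lemma zcos_mod (R : realType) (n a : nat) : (0 < n)%N ->
  cos ((a %% n)%:R * (pi *+ 2 / n%:R)) = cos (a%:R * (pi *+ 2 / n%:R)) :> R.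
Proof.
move=> n0; have nR : n%:R != 0 :> R by rewrite pnatr_eq0 -lt0n.
set t := _ / _; have nt : n%:R * t = pi *+ 2 by rewrite /t mulrCA divff // mulr1.
rewrite {2}(divn_eq a n) natrD natrM (mulrDl _ _ t) -mulrA nt.
by rewrite [_ * (pi *+ 2)]mulr_natl [X in _ = cos X]addrC (periodicn (@cosD2pi R)).
Qed.

Lemma zsin_mod (R : realType) (n a : nat) : (0 < n)%N ->
  sin ((a %% n)%:R * (pi *+ 2 / n%:R)) = sin (a%:R * (pi *+ 2 / n%:R)) :> R.
Proof.
move=> n0; have nR : n%:R != 0 :> R by rewrite pnatr_eq0 -lt0n.
set t := _ / _; have nt : n%:R * t = pi *+ 2 by rewrite /t mulrCA divff // mulr1.
rewrite {2}(divn_eq a n) natrD natrM (mulrDl _ _ t) -mulrA nt.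
by rewrite [_ * (pi *+ 2)]mulr_natl [X in _ = sin X]addrC (periodicn (@sinD2pi R)).
Qed.

Section Characters.
Variables (R : realType) (n : nat).
Hypothesis n1 : (1 < n)%N.
Implicit Types (d e g h k : 'Z_n).
Local Notation C := (@zcos R n).
Local Notation S := (@zsin R n).

Lemma zcosD d e : C (d + e) = C d * C e - S d * S e.
Proof. by rewrite /zcos val_ZpD // zcos_mod 1?ltnW // natrD mulrDl cosD. Qed.

Lemma zsinD d e : S (d + e) = S d * C e + C d * S e.
Proof. by rewrite /zsin val_ZpD // zsin_mod 1?ltnW // natrD mulrDl sinD. Qed.

Lemma zcos0 : C 0 = 1. Proof. by rewrite /zcos mul0r cos0. Qed.
Lemma zsin0 : S 0 = 0. Proof. by rewrite /zsin mul0r sin0. Qed.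

(** The addition formulas at [d + (-d) = 0], with [C^2 + S^2 = 1], determine both values at [-d]
    without computing its representative. *)
Lemma zcosN d : C (- d) = C d.
Proof.
have := zcosD d (-d); have := zsinD d (-d); rewrite subrr zcos0 zsin0.
have := cos2Dsin2 (d%:R * (pi *+ 2 / n%:R) : R); rewrite -/(C d) -/(S d) => cs e1 e2.
rewrite -[LHS]mul1r -cs -[RHS]mulr1 e2 -[RHS]addr0 -[0](mulr0 (S d)) e1; ring.
Qed.

Lemma zsinN d : S (- d) = - S d.
Proof.
have := zcosD d (-d); have := zsinD d (-d); rewrite subrr zcos0 zsin0 zcosN.
have := cos2Dsin2 (d%:R * (pi *+ 2 / n%:R) : R); rewrite -/(C d) -/(S d) => cs e1 e2.
rewrite -[LHS]mul1r -cs -[RHS]mulr1 e2 -[RHS]addr0 -[0](mulr0 (C d)) e1; ring.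
Qed.

(** [1 - C d = 2 sin^2(pi d / n)], and the angle lies strictly between 0 and [pi]. *)
Lemma zcos_neq1 d : d != 0 -> C d != 1.
Proof.
move=> d0; have nR : (0 : R) < n%:R by rewrite ltr0n ltnW.
set t : R := d%:R * (pi / n%:R).
have dn : (d%:R : R) < n%:R by rewrite ltr_nat ltn_Zp.
have dp : (0 : R) < d%:R by rewrite ltr0n lt0n.
have p0 := pi_gt0 R.
have s0 : 0 < sin t.
  apply: sin_gt0_pi; rewrite /t mulr_gt0 ?divr_gt0 //= mulrCA.
  by rewrite gtr_pMr // ltr_pdivrMr // mul1r.
have -> : C d = cos (t *+ 2) by rewrite /zcos /t; congr cos; ring.
rewrite cos_mulr2n cos2sin2.
apply/eqP => e; have /eqP : sin t ^+ 2 = 0 by lra.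
by rewrite sqrf_eq0 gt_eqF.
Qed.

(** Orthogonality of characters. The sine sum cancels under [k -> -k], so the shift [k -> k + 1]
    multiplies the cosine sum by [C d], which differs from 1 when [d != 0]. *)
Lemma sum_zcos d : \sum_k C (k * d) = (d == 0)%:R * n%:R.
Proof.
have [->|d0] := eqVneq d 0.
  under eq_bigr do rewrite mulr0 zcos0.
  by rewrite sumr_const card_ord_Zp // mul1r.
have S0 : \sum_k S (k * d) = 0.
  have e : \sum_k S (k * d) = - \sum_k S (k * d).
    rewrite {1}(reindex_inj (@oppr_inj 'Z_n)) -sumrN.
    by apply: eq_bigr => k _; rewrite mulNr zsinN.
  by lra.
have : \sum_k C (k * d) = \sum_k C (k * d) * C d - \sum_k S (k * d) * S d.
  rewrite (reindex_inj (addIr (1 : 'Z_n))) -sumrB.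
  by apply: eq_bigr => k _; rewrite mulrDl mul1r zcosD.
rewrite -!mulr_suml S0 mul0r subr0 mul0r => e.
have /eqP : (\sum_k C (k * d)) * (1 - C d) = 0 by rewrite mulrBr mulr1 {1}e subrr.
rewrite mulf_eq0 subr_eq0 [1 == _]eq_sym (negbTE (zcos_neq1 d0)) orbF.
by move/eqP.
Qed.

Definition autocorr (z : 'Z_n -> R) g : R := \sum_h z h * z (h - g).

(** The squared modulus of the Fourier coefficient of [z] at frequency [k]. *)
Definition spectrum (z : 'Z_n -> R) k : R :=
  (\sum_h z h * C (k * h)) ^+ 2 + (\sum_h z h * S (k * h)) ^+ 2.

Lemma spectrum_ge0 z k : 0 <= spectrum z k.
Proof. by rewrite addr_ge0 ?sqr_ge0. Qed.

Lemma spectrum_shift z k g :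
  spectrum z k * C (k * g) = \sum_h \sum_e z h * z e * C (k * (h - e - g)).
Proof.
set A := \sum_h z h * C (k * h); set B := \sum_h z h * S (k * h).
(* The added sine coefficient [B * A - A * B] is zero; its expansion supplies the terms that the
   addition formulas need summand by summand. *)
have -> : spectrum z k * C (k * g) =
    (A * A + B * B) * C (k * g) + (B * A - A * B) * S (k * g).
  by rewrite /spectrum -/A -/B; ring.
rewrite /A /B !big_distrlr /= -!sumrB -!big_split /= !mulr_suml -big_split /=.
apply: eq_bigr => h _; rewrite -sumrB -big_split /= !mulr_suml -big_split /=.
apply: eq_bigr => e _; rewrite !mulrBr !zcosD !zsinD !zcosN !zsinN; ring.
Qed.

(** The Wiener-Khinchin identity: after exchanging sums, orthogonality keeps only [e = h - g]. *)
Lemma autocorr_spectrum z g :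
  n%:R * autocorr z g = \sum_k spectrum z k * C (k * g).
Proof.
under eq_bigr do rewrite spectrum_shift.
rewrite exchange_big /autocorr mulr_sumr; apply: eq_bigr => h _ /=.
rewrite exchange_big /= (bigD1 (h - g)) //= [X in _ = _ + X]big1 => [|e he].
  by rewrite -mulr_sumr sum_zcos addr0 subKr subrr eqxx mul1r mulrC.
rewrite -mulr_sumr sum_zcos addrAC subr_eq0 eq_sym (negbTE he).
by rewrite mul0r mulr0.
Qed.

End Characters.

(** * Reflection and parity on an even cycle; positivity of the spectral gap *)

Lemma fold_sum (R : realType) (m : nat) (F : nat -> R) :
  F 0 = 0 -> (forall i, (i <= m)%N -> F (m + i)%N = F (m - i)%N) ->
  \sum_(g < m + m) F g = 2 * \sum_(g < m) F g + F m.
Proof.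
move=> F0 Fsym; rewrite big_split_ord /=.
(* [F 0 = 0] lets the reflected half run over all of [0..m], so that [F m] is the one term left
   unpaired. *)
have -> : \sum_(i < m) F (m + i)%N = \sum_(i < m.+1) F (m - i)%N.
  rewrite big_ord_recr /= subnn F0 addr0; apply: eq_bigr => i _.
  by rewrite Fsym // ltnW.
have -> : \sum_(i < m.+1) F (m - i)%N = \sum_(i < m.+1) F i.
  rewrite (reindex_inj rev_ord_inj) /=; apply: eq_bigr => i _.
  by rewrite subSS subKn // -ltnS.
by rewrite big_ord_recr /= addrA mulr2n mulrDl mul1r.
Qed.

Lemma card_S_even_odd (n m : nat) : (0 < m)%N -> n = (m + m)%N ->
  #|S_even n| = m /\ #|S_odd n| = m.
Proof.
move=> m0 nE; have n1 : (1 < n)%N by rewrite nE; lia.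
have n_even : ~~ odd n by rewrite nE addnn odd_double.
have cE : #|S_even n| = #|S_odd n|.
  rewrite -(card_imset (S_even n) (addIr (-1 : 'Z_n))); apply: eq_card => g.
  apply/imsetP/idP => [[h hE ->]|gO].
    by move: hE; rewrite !inE odd_ZpB // => /negbTE ->; rewrite addFb.
  exists (g + 1); last by rewrite addrK.
  by have := odd_ZpB (g + 1) 1 n1 n_even; move: gO; rewrite addrK !inE addbT => -> <-.
have : (#|S_even n| + #|S_odd n| = n)%N.
  have -> : S_odd n = ~: S_even n by apply/setP => g; rewrite !inE negbK.
  by rewrite cardsC card_ord_Zp.
by rewrite cE; lia.
Qed.

Section EvenCycle.
Variables (R : realType) (n m : nat).
Hypotheses (m0 : (0 < m)%N) (nE : n = (m + m)%N).
Implicit Types (d e g h k : 'Z_n).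
Local Notation C := (@zcos R n).

Let n1 : (1 < n)%N.
Proof. by rewrite nE; lia. Qed.

Let n_even : ~~ odd n.
Proof. by rewrite nE addnn odd_double. Qed.

Let nR : (n%:R : R) != 0.
Proof. by rewrite pnatr_eq0; lia. Qed.

Let nER : (n%:R : R) = m%:R + m%:R.
Proof. by rewrite nE natrD. Qed.

(** The character of frequency [m]; it is multiplicative because [n] is even. *)
Definition zsign g : R := (-1) ^+ g.

Lemma zsignB d e : zsign (d - e) = zsign d * zsign e.
Proof. by rewrite /zsign -signr_odd odd_ZpB // signr_addb !signr_odd. Qed.

Lemma zsign_sqr g : zsign g * zsign g = 1.
Proof. by rewrite -zsignB subrr. Qed.

Definition zpot g : R := (lee_weight n g)%:R^-1.

Lemma zpot0 : zpot 0 = 0.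
Proof. by rewrite /zpot /lee_weight min0n invr0. Qed.

(* The difference of the eigenvalues of A at the frequencies k + m and m. *)
Definition gap k : R := \sum_g zsign g * zpot g * (C (k * g) - 1).

Lemma gapN k : gap (- k) = gap k.
Proof. by apply: eq_bigr => g _; rewrite mulNr zcosN. Qed.

(** The summands at [g] and [n - g] agree, so the sum over the cycle folds onto [0..m]. *)
Lemma gapE k : gap k = 2 * alt_sum m (k%:R * (pi / m%:R)).
Proof.
have mR : (m%:R : R) != 0 by rewrite pnatr_eq0 -lt0n.
set x : R := k%:R * _.
have mx : m%:R * x = pi *+ k.
  by rewrite /x mulrCA [m%:R * _]mulrC divfK // mulr_natl.
pose F (g : nat) : R := (-1) ^+ g * (lee_weight n g)%:R^-1 * (cos (g%:R * x) - 1).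
have -> : gap k = \sum_(g : 'Z_n) F g.
  apply: eq_bigr => g _; rewrite /F /zcos val_ZpM // zcos_mod ?(ltnW n1) //.
  congr (_ * (cos _ - 1)); rewrite /x natrM nER; field.
  by rewrite mR -nER nR.
rewrite (sum_Zp F) // [in LHS]nE fold_sum.
- rewrite /alt_sum mulrDr; congr (2 * _ + _).
    apply: eq_bigr => i _; rewrite /F /alt_term; congr (_ * _%:R^-1 * _).
    by rewrite /lee_weight nE; have := ltn_ord i; lia.
  rewrite [2 * _]mulrC divfK ?pnatr_eq0 // /F /alt_term.
  by congr (_ * _%:R^-1 * _); rewrite /lee_weight nE; lia.
- by rewrite /F mul0r cos0 subrr mulr0.
move=> i im; rewrite /F; congr (_ * _%:R^-1 * (_ - 1)).
- by rewrite -signr_odd oddD -oddB // signr_odd.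
- by rewrite /lee_weight nE; lia.
rewrite natrD natrB // mulrDl mulrBl mx.
(* Since [m x = k pi], the angles [(m + i) x] and [-(m - i) x] differ by a multiple of [2 pi]. *)
have -> : pi *+ k + i%:R * x = - (pi *+ k - i%:R * x) + pi *+ 2 *+ k.
  have -> : pi *+ 2 *+ k = (pi : R) *+ k *+ 2 by exact: mulrnAC.
  by ring.
by rewrite (periodicn (@cosD2pi R)) cosN.
Qed.

Lemma gap_gt0 k : k != 0 -> 0 < gap k.
Proof.
(* [gap] is even in [k], so [k] may be replaced by [n - k]; then [k pi / m] lies in
   [[pi / m, pi]]. *)
wlog km : k / (k <= m)%N => [hwlog|] k0.
  have [/hwlog->//|mk] := leqP k m.
  rewrite -gapN hwlog ?oppr_eq0 //.
  by have := ltn_Zp k n1; rewrite val_ZpN // modn_small; lia.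
have mR : (0 : R) < m%:R by rewrite ltr0n.
have pm0 : (0 : R) < pi / m%:R by rewrite divr_gt0 // pi_gt0.
rewrite gapE mulr_gt0 // alt_sum_gt0 //; apply/andP; split.
  by rewrite ler_peMl ?ler1n ?lt0n // ltW.
by rewrite mulrCA ler_piMr ?pi_ge0 // ler_pdivrMr // mul1r ler_nat.
Qed.

(** * The defect, a quadratic form with nonnegative spectral weights *)

Definition defect (z : 'Z_n -> R) : R :=
  \sum_g zsign g * zpot g * (autocorr z g - autocorr z 0).

Lemma defect_gap z : n%:R * defect z = \sum_k spectrum z k * gap k.
Proof.
rewrite mulr_sumr; under [RHS]eq_bigr do rewrite mulr_sumr.
rewrite exchange_big; apply: eq_bigr => g _ /=.
rewrite mulrCA mulrBr !autocorr_spectrum // -sumrB mulr_sumr.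
by apply: eq_bigr => k _; rewrite mulr0 zcos0; ring.
Qed.

Lemma spectrum_gap_ge0 z k : 0 <= spectrum z k * gap k.
Proof.
have [->|k0] := eqVneq k 0; last by rewrite mulr_ge0 ?spectrum_ge0 // ltW // gap_gt0.
rewrite /gap big1 ?mulr0 // => g _.
by rewrite mul0r zcos0 subrr mulr0.
Qed.

Lemma defect_ge0 z : 0 <= defect z.
Proof.
have n0 : (0 : R) < n%:R by rewrite ltr0n ltnW.
rewrite -(pmulr_rge0 _ n0) defect_gap sumr_ge0 // => k _.
exact: spectrum_gap_ge0.
Qed.

Lemma autocorr_shift (z : 'Z_n -> R) h g : autocorr (fun e => z (e + h)) g = autocorr z g.
Proof.
rewrite /autocorr [RHS](reindex_inj (addIr h)).
by apply: eq_bigr => e _; rewrite addrAC.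
Qed.

(** Turns equality of the autocorrelations at 0 and 1 into constancy of [z], which replaces Fourier
    inversion. *)
Lemma sum_sqr_shift (z : 'Z_n -> R) :
  \sum_h (z h - z (h - 1)) ^+ 2 = 2 * (autocorr z 0 - autocorr z 1).
Proof.
have e : autocorr z 0 = \sum_h z (h - 1) * z (h - 1).
  rewrite -(autocorr_shift z (-1)).
  by apply: eq_bigr => h _; rewrite subr0.
rewrite mulrBr {1}mulr2n mulrDl mul1r {2}e /autocorr -!big_split /= mulr_sumr -sumrB.
by apply: eq_bigr => h _; rewrite subr0; ring.
Qed.

(** Positive gaps kill every mode but [k = 0]. The autocorrelation is then constant in [g], hence
    [z h = z (h - 1)] for all [h]. *)
Lemma defect_eq0 z : defect z = 0 -> forall h, z h = z 0.
Proof.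
move=> z0; have sp0 k : k != 0 -> spectrum z k = 0.
  move=> k0; have : \sum_k spectrum z k * gap k == 0 by rewrite -defect_gap z0 mulr0.
  rewrite psumr_eq0 => [/allP /(_ k)|? _]; last exact: spectrum_gap_ge0.
  rewrite mem_index_enum => /(_ isT) /=.
  by rewrite mulf_eq0 (gt_eqF (gap_gt0 k0)) orbF => /eqP.
have ac g : n%:R * autocorr z g = spectrum z 0.
  rewrite autocorr_spectrum // (bigD1 0) //= big1 ?mul0r ?zcos0 ?mulr1 ?addr0 //.
  by move=> k k0; rewrite sp0 ?mul0r.
have ac01 : autocorr z 0 = autocorr z 1 by apply: (mulfI nR); rewrite !ac.
have /eqP := sum_sqr_shift z; rewrite ac01 subrr mulr0.
rewrite psumr_eq0 => [/allP step|? _]; last exact: sqr_ge0.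
have {}step h : z h = z (h - 1).
  have := step h; rewrite mem_index_enum => /(_ isT) /=.
  by rewrite sqrf_eq0 subr_eq0 => /eqP.
move=> h; rewrite -[h]natr_Zp; elim: (nat_of_ord h) => [|i IH] //.
by rewrite step -IH mulrSr addrK.
Qed.

Lemma defect_const z : (forall h, z h = z 0) -> defect z = 0.
Proof.
move=> zc; apply: big1 => g _; rewrite /autocorr -sumrB big1 ?mulr0 // => h _.
by rewrite (zc (h - g)) (zc (h - 0)) subrr.
Qed.

(** * Fractional energy under the two constraints *)

Implicit Types (x : {ffun 'Z_n -> R}) (S T : {set 'Z_n}).
Local Notation u := (@lee_potential R n).

Definition feasible x := inner x x = n%:R / 2 /\ inner x all_one = n%:R / 2.

Definition twist x (h : 'Z_n) : R := zsign h * (x h - 2^-1).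

(** The energy of a checkerboard, whose autocorrelation at [g] is [n / 2] for even [g] and 0 for odd
    [g]. *)
Definition min_energy : R := \sum_g (1 + zsign g) * zpot g * (n%:R / 4).

Lemma sum_shift (f : 'Z_n -> R) g : \sum_h f (h - g) = \sum_h f h.
Proof. by rewrite [RHS](reindex_inj (addIr (- g))). Qed.

(** The signs at [h] and [h - g] multiply to [zsign g]; expanding the product of the centred values
    and using [(x|1) = n/2] leaves the constant [n / 4]. *)
Lemma autocorr_twist x g : feasible x ->
  autocorr x g = n%:R / 4 + zsign g * autocorr (twist x) g.
Proof.
case=> _; rewrite /inner; under eq_bigr do rewrite ffunE mulr1.
move=> sx; have sxg : \sum_h x (h - g) = n%:R / 2 by rewrite sum_shift.
have -> : zsign g * autocorr (twist x) g =
    \sum_h (x h * x (h - g) - (2^-1 * x h + (2^-1 * x (h - g) - 4^-1))).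
  rewrite mulr_sumr; apply: eq_bigr => h _; rewrite /twist zsignB.
  have -> : zsign g * (zsign h * (x h - 2^-1) * (zsign h * zsign g * (x (h - g) - 2^-1)))
   = (zsign g * zsign g) * (zsign h * zsign h) * ((x h - 2^-1) * (x (h - g) - 2^-1)) by ring.
  by rewrite !zsign_sqr; field.
rewrite sumrB !big_split /= sumrN -!mulr_sumr sx sxg sumr_const card_ord_Zp //.
rewrite -[4^-1 *+ n]mulr_natl -/(autocorr x g).
by field.
Qed.

Lemma inner_energy_kernel x :
  inner x (energy_kernel u x) = \sum_g zpot g * autocorr x g.
Proof.
rewrite /inner; under eq_bigr do rewrite ffunE mulr_sumr.
rewrite exchange_big [RHS](bigD1 0) //= zpot0 mul0r add0r.
apply: eq_bigr => g _; rewrite /autocorr mulr_sumr; apply: eq_bigr => h _.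
by rewrite lee_potentialE // subr0 mulrCA.
Qed.

(** The constraint [(x|x) = n/2] fixes the autocorrelation of the twist at 0 to [n / 4], so the term
    subtracted in [defect] is a constant. *)
Lemma energyE x : feasible x ->
  inner x (energy_kernel u x) = min_energy + defect (twist x).
Proof.
move=> fx; have ac0 : autocorr (twist x) 0 = n%:R / 4.
  have := autocorr_twist 0 fx; rewrite /zsign expr0 mul1r.
  have -> : autocorr x 0 = n%:R / 2.
    by rewrite -fx.1; apply: eq_bigr => h _; rewrite subr0.
  by move=> e; lra.
rewrite inner_energy_kernel /min_energy /defect -big_split /=.
by apply: eq_bigr => g _; rewrite autocorr_twist // ac0; ring.
Qed.

Lemma char_vec_inner S :
  inner (char_vec R S) (char_vec R S) = #|S|%:R /\
  inner (char_vec R S) all_one = #|S|%:R.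
Proof.
rewrite /inner; split; rewrite -sum1_card natr_sum [RHS]big_mkcond /=;
  by apply: eq_bigr => g _; rewrite !ffunE; case: (g \in S); rewrite ?mulr1 ?mulr0.
Qed.

Lemma half_n : (n%:R / 2 : R) = m%:R.
Proof. by rewrite nER; field. Qed.

Lemma char_vec_feasible S : #|S| = m -> feasible (char_vec R S).
Proof. by move=> cS; have [e1 e2] := char_vec_inner S; rewrite /feasible e1 e2 cS half_n. Qed.

Lemma char_vec_inj : injective (@char_vec R n).
Proof.
move=> S T /ffunP e; apply/setP => g; have := e g; rewrite !ffunE.
by move/eqP; rewrite eqr_nat; case: (g \in S); case: (g \in T).
Qed.

Lemma energy_min x : feasible x ->
  min_energy <= inner x (energy_kernel u x) /\
  (inner x (energy_kernel u x) = min_energy <->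
   x = char_vec R (S_even n) \/ x = char_vec R (S_odd n)).
Proof.
move=> fx; rewrite energyE // lerDl defect_ge0; split=> //; split.
  move=> /eqP; rewrite -subr_eq0 addrAC subrr add0r => /eqP /defect_eq0 zc.
  have xE h : x h = zsign h * twist x 0 + 2^-1.
    by rewrite -(zc h) /twist mulrA zsign_sqr mul1r subrK.
  (* The twist is a constant [c], so the norm constraint reads [n/2 = n/4 + n c^2]. *)
  have : twist x 0 ^+ 2 = 4^-1.
    have := autocorr_twist 0 fx; rewrite /zsign expr0 mul1r.
    have -> : autocorr x 0 = n%:R / 2.
      by rewrite -fx.1; apply: eq_bigr => h _; rewrite subr0.
    rewrite /autocorr; under eq_bigr do rewrite (zc (_ - 0)) zc.
    rewrite sumr_const card_ord_Zp // -mulr_natl => e.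
    apply: (mulfI nR); rewrite expr2; lra.
  move=> c2; have /eqP : (twist x 0 - 2^-1) * (twist x 0 + 2^-1) = 0.
    by rewrite -subr_sqr c2; field.
  rewrite mulf_eq0 subr_eq0 addr_eq0 => /orP[] /eqP c; [left|right];
    apply/ffunP => h; rewrite xE c ffunE inE /zsign -signr_odd;
    by case: odd; rewrite ?expr1 ?expr0 /=; field.
case=> ->; rewrite defect_const ?addr0 // => h; rewrite /twist !ffunE !inE /zsign;
  by rewrite -signr_odd; case: odd; rewrite ?expr1 ?expr0 /=; field.
Qed.

(** * Total and maximal energy of subsets *)

Lemma total_energyE S :
  total_energy u S = inner (char_vec R S) (energy_kernel u (char_vec R S)).
Proof.
rewrite /total_energy /inner big_mkcond; apply: eq_bigr => h _.
rewrite !ffunE; case: (h \in S); last by rewrite mul0r.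
rewrite mul1r /energy (reindex_inj (can_inj (subKr h))) /=.
rewrite [LHS]big_mkcond [RHS]big_mkcond; apply: eq_bigr => g _.
rewrite !inE ffunE -[X in _ != X]subr0 (inj_eq (can_inj (subKr h))).
case: (g != 0) => //=; rewrite !lee_potentialE // subKr subr0.
by case: (_ \in S); rewrite ?mulr1 ?mulr0.
Qed.

Lemma total_energy_min S : #|S| = m ->
  min_energy <= total_energy u S /\
  (total_energy u S = min_energy <-> S = S_even n \/ S = S_odd n).
Proof.
move=> cS; rewrite total_energyE; have [le_min min_iff] := energy_min (char_vec_feasible cS).
split=> //; rewrite min_iff; split=> [] [].
- by move=> /char_vec_inj; left.
- by move=> /char_vec_inj; right.
- by move=> ->; left.
- by move=> ->; right.
Qed.

Lemma total_energy_le_max S : total_energy u S <= #|S|%:R * max_energy u S.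
Proof.
rewrite mulr_natl -sumr_const; apply: ler_sum => h hS; exact: max_energy_ge.
Qed.

(** The substitution [g -> h - g] carries either checkerboard containing [h] onto [S_even], so all
    its points have the same energy. *)
Lemma energy_checkerboard S h : S = S_even n \/ S = S_odd n -> h \in S ->
  energy u S h = \sum_(g in S_even n :\ 0) zpot g.
Proof.
move=> SE hS; rewrite /energy (reindex_inj (can_inj (subKr h))) /=.
apply: eq_big => g; last by rewrite lee_potentialE // subKr.
rewrite !inE -[X in _ != X]subr0 (inj_eq (can_inj (subKr h))).
by case: SE hS => ->; rewrite !inE odd_ZpB //; [move/negPf=> -> | move=> ->].
Qed.

Lemma max_energy_checkerboard S : S = S_even n \/ S = S_odd n ->
  total_energy u S = m%:R * max_energy u S.
Proof.
move=> SE; have cS : #|S| = m by case: SE => ->; have [] := card_S_even_odd m0 nE.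
have [|h hS ->] := @max_energy_attained R n u S; first by rewrite -card_gt0 cS.
rewrite -cS mulr_natl -sumr_const; apply: eq_bigr => g gS.
by rewrite !energy_checkerboard.
Qed.

Lemma max_energy_min S : #|S| = m ->
  min_energy <= m%:R * max_energy u S /\
  (m%:R * max_energy u S = min_energy <-> S = S_even n \/ S = S_odd n).
Proof.
move=> cS; have [le_min min_iff] := total_energy_min cS.
have le_max := total_energy_le_max S; rewrite cS in le_max.
split; first exact: le_trans le_max.
split=> [e|SE]; last by rewrite -max_energy_checkerboard // min_iff.
(* If [m E_max] equals the minimum, [E_tot] is squeezed between the two and the equality case for
   total energy applies. *)
by apply/min_iff/eqP; rewrite eq_le le_min -e le_max.
Qed.

End EvenCycle.

(** * Minimisers from a sharp lower bound *)

Lemma minimizerP (R : realType) (T : Type) (P : T -> Prop) (f : T -> R) (c : R)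
    (a b : T) :
  P a -> P b ->
  (forall y, P y -> c <= f y /\ (f y = c <-> y = a \/ y = b)) ->
  forall x, minimizer P f x <-> x = a \/ x = b.
Proof.
move=> Pa Pb fP x; split=> [[Px xmin]|xab].
  apply/(fP x Px).2/eqP; rewrite eq_le (fP x Px).1 andbT.
  by have <- : f a = c by [apply/(fP a Pa).2; left]; exact: xmin.
have Px : P x by case: xab => ->.
by split=> // y Py; rewrite ((fP x Px).2.2 xab) (fP y Py).1.
Qed.

Theorem theorem3p1 (R : realType) (n : nat) (n_gt0 : (0 < n)%N)
    (n_even : (2 %| n)%N) :
  let u := @lee_potential R n in
  [/\ forall x : {ffun 'Z_n -> R},
        minimizer (fun y => inner y y = n%:R / 2 /\ inner y all_one = n%:R / 2)
                  (fun y => inner y (energy_kernel u y)) x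
        <-> x = char_vec R (S_even n) \/ x = char_vec R (S_odd n),
      forall S : {set 'Z_n},
        minimizer (fun T : {set 'Z_n} => #|T| = n./2) (total_energy u) S
        <-> S = S_even n \/ S = S_odd n
    & forall S : {set 'Z_n},
        minimizer (fun T : {set 'Z_n} => #|T| = n./2) (max_energy u) S
        <-> S = S_even n \/ S = S_odd n].
Proof.
move=> u.
have nE : n = (n./2 + n./2)%N by rewrite addnn even_halfK // -dvdn2.
have m0 : (0 < n./2)%N by move: n_gt0; rewrite {1}nE; lia.
have [cE cO] := card_S_even_odd m0 nE.
have mR : (0 : R) < n./2%:R by rewrite ltr0n.
split.
- apply: (minimizerP (c := min_energy R n)) => [||y /(energy_min m0 nE)] //;
  exact: (char_vec_feasible R nE).
- by apply: (minimizerP (c := min_energy R n)) => // y /(total_energy_min R m0 nE).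
(* The available bound is on [m E_max] with [m = n/2], hence the division. *)
apply: (minimizerP (c := min_energy R n / n./2%:R)) => // T cT.
have [le_min min_iff] := max_energy_min R m0 nE cT.
rewrite ler_pdivrMr // mulrC; split=> //; rewrite -min_iff.
split=> [->|<-]; first by rewrite mulrC divfK // gt_eqF.
by rewrite [_ * max_energy _ _]mulrC mulfK // gt_eqF.
Qed.
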